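(* Let $t \ge 3$ and $\lambda \ge 1$ be integers. Then the complete digraph $\overleftrightarrow{K}_{t+\lambda}$ on $t+\lambda$ vertices is the only two-way $(t,\lambda)$-liking digraph; that is, every two-way $(t,\lambda)$-liking digraph is isomorphic to $\overleftrightarrow{K}_{t+\lambda}$.
   Context: All digraphs are finite, with no loops and no multiple arcs. For positive integers $t$ and $\lambda$, a digraph is a two-way $(t,\lambda)$-liking digraph if every set of $t$ distinct vertices has exactly $\lambda$ common out-neighbors and exactly $\lambda$ common in-neighbors. The complete digraph $\overleftrightarrow{K}_m$ is the digraph on $m$ vertices in which, for every pair $x,y$ of distinct vertices, both arcs $(x,y)$ and $(y,x)$ are present.
   Formalization: Uniqueness is stated for digraphs with at least t vertices, since on fewer than t vertices the liking condition holds vacuously (e.g. 2 vertices with no arcs) and such digraphs are not isomorphic to the complete digraph on t+λ vertices. *)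

(* Defs.v *)
From HB Require Import structures.
From mathcomp Require Import all_boot.

Set Implicit Arguments.
Unset Strict Implicit.
Unset Printing Implicit Defensive.

Record digraph := Digraph {
  vertex :> finType;
  arc : rel vertex;
  arc_irr : irreflexive arc
}.

Definition common_out (D : digraph) (S : {set D}) : {set D} :=
  [set y | [forall x in S, arc x y]].

Definition common_in (D : digraph) (S : {set D}) : {set D} :=
  [set y | [forall x in S, arc y x]].

(* Vacuously true when D has fewer than t vertices. *)
Definition two_way_liking (t lambda : nat) (D : digraph) : Prop :=
  forall S : {set D}, #|S| = t ->
    #|common_out S| = lambda /\ #|common_in S| = lambda.

Definition digraph_iso (D E : digraph) : Prop :=
  exists2 f : D -> E, bijective f & forall x y, arc (f x) (f y) = arc x y.

Lemma complete_irr (m : nat) : irreflexive (fun x y : 'I_m => x != y).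
Proof. by move=> x; rewrite eqxx. Qed.

Definition complete_digraph (m : nat) : digraph := Digraph (@complete_irr m).

(* Main.v *)
Require Import Defs.
From HB Require Import structures.
From mathcomp Require Import all_boot.
From mathcomp Require Import all_order all_algebra.
(* Gives [Defs.arc] precedence over [path.arc]. *)
Import Defs.

Set Implicit Arguments.
Unset Strict Implicit.
Unset Printing Implicit Defensive.

(** Fix [t - 2] vertices [T].  The vertices outside [T], as points, and the
    common out-neighbours of [T], as blocks, form a pairwise balanced design: any
    two points lie on exactly [lambda] blocks.  Absence of loops makes each point
    lie on more than [lambda] blocks, so Fisher's inequality bounds the number of
    points by the number of blocks.  Blocks are themselves vertices outside [T],
    hence [T] dominates every vertex outside [T].  As [t >= 3], every vertex
    lies in such a [T], so the digraph is complete. *)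

Section Fisher.
Import Order.TTheory GRing.Theory Num.Theory.
Local Open Scope ring_scope.

(* For the incidence matrix [A], the Gram matrix [A *m A^T] is [lambda] times
   the all-ones matrix plus a positive diagonal, hence positive definite. *)
Lemma fisher_inequality (T U : finType) (P : {set T}) (B : {set U})
    (inc : T -> U -> bool) (lambda : nat) :
  {in P &, forall p q, p != q ->
     #|[set b in B | inc p b && inc q b]| = lambda} ->
  {in P, forall p, lambda < #|[set b in B | inc p b]|}%N ->
  (#|P| <= #|B|)%N.
Proof.
move=> pairP degP.
pose A : 'M[rat]_(#|P|, #|B|) :=
  \matrix_(i, j) (inc (enum_val i) (enum_val j))%:R.
suff: row_free A by move/eqP <-; exact: rank_leq_col.
rewrite -kermx_eq0; apply/rowV0P => v /sub_kermxP vA0.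
pose d (i : 'I_#|P|) := #|[set b in B | inc (enum_val i) b]|.
(* The truncated subtraction [d i - lambda] is exact by [degP]. *)
have gram i j : \sum_k A i k * A j k =
    lambda%:R + (i == j)%:R * (d i - lambda)%:R.
  have -> : \sum_k A i k * A j k =
      #|[set b in B | inc (enum_val i) b && inc (enum_val j) b]|%:R.
    under eq_bigr => k _ do rewrite !mxE -natrM mulnb.
    rewrite -natr_sum; congr (_%:R).
    rewrite -(big_enum_val
      (fun b => (inc (enum_val i) b && inc (enum_val j) b : nat))) /=.
    rewrite -sum1_card -big_mkcondr /=.
    by apply: eq_bigl => b; rewrite inE.
  case: eqVneq => [<-|ij].
    rewrite mul1r -natrD subnKC; last exact/ltnW/degP/enum_valP.
    by congr (_%:R); apply: eq_card => b; rewrite !inE andbb.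
  rewrite mul0r addr0 pairP ?enum_valP //.
  by apply: contra_neq ij; exact: enum_val_inj.
(* The left side is the Gram form at [v], that is, the squared norm of [v *m A], which vanishes. *)
have quad : lambda%:R * (\sum_i v 0 i) ^+ 2
    + \sum_i (d i - lambda)%:R * v 0 i ^+ 2 = 0.
  transitivity (\sum_k (v *m A) 0 k ^+ 2); last first.
    by rewrite vA0 big1 // => k _; rewrite mxE expr0n.
  transitivity (\sum_i \sum_j v 0 i * v 0 j * \sum_k A i k * A j k).
    rewrite expr2 mulr_suml mulr_sumr -big_split /=; apply: eq_bigr => i _.
    under [RHS]eq_bigr => j _ do rewrite gram mulrDr.
    rewrite big_split /= -mulr_suml -mulr_sumr mulrC; congr (_ + _).
    rewrite (bigD1 i) //= eqxx mul1r big1 ?addr0 1?mulrC //.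
    by move=> j; rewrite eq_sym => /negPf ->; rewrite mul0r mulr0.
  under eq_bigr => i _ do under eq_bigr => j _ do rewrite mulr_sumr.
  under eq_bigr => i _ do rewrite exchange_big /=.
  rewrite exchange_big /=; apply: eq_bigr => k _.
  rewrite mxE expr2 mulr_suml; apply: eq_bigr => i _.
  by rewrite mulr_sumr; apply: eq_bigr => j _; rewrite mulrACA.
have term_ge0 i : 0 <= (d i - lambda)%:R * v 0 i ^+ 2.
  by rewrite mulr_ge0 ?ler0n ?sqr_ge0.
have sq_ge0 : 0 <= lambda%:R * (\sum_i v 0 i) ^+ 2.
  by rewrite mulr_ge0 ?ler0n ?sqr_ge0.
have sum_ge0 : 0 <= \sum_i (d i - lambda)%:R * v 0 i ^+ 2.
  by apply: sumr_ge0 => i _.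
move/eqP: quad; rewrite paddr_eq0 // => /andP[_ /eqP sum0].
apply/rowP => i; rewrite mxE; apply/eqP.
(* Each term vanishes, while its coefficient is nonzero by [degP]; so [v 0 i = 0]. *)
have /eqP := psumr_eq0P (fun i _ => term_ge0 i) sum0 (i := i) isT.
rewrite mulf_eq0 sqrf_eq0 pnatr_eq0 subn_eq0 leqNgt.
by rewrite (degP _ (enum_valP i)).
Qed.

End Fisher.

Lemma set_of_card (T : finType) (A : {set T}) (n : nat) :
  #|A| <= n <= #|T| -> exists2 B : {set T}, A \subset B & #|B| = n.
Proof.
case/andP; elim: n => [|n IH] leAn lenT.
  by exists A => //; apply/eqP; rewrite -leqn0.
move: leAn; rewrite leq_eqVlt => /orP[/eqP cA|leAn]; first by exists A.
have [B sAB cB] := IH leAn (ltnW lenT).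
have /set0Pn[x] : ~: B != set0 by rewrite -card_gt0 cardsCs setCK cB subn_gt0.
rewrite inE => xB; exists (x |: B); last by rewrite cardsU1 xB cB.
exact: subset_trans sAB (subsetUr _ _).
Qed.

Section Liking.
Variables (t lambda : nat) (D : digraph).
Hypothesis liking : forall S : {set D}, #|S| = t -> #|common_out S| = lambda.

Lemma common_out_disjoint (S : {set D}) : common_out S \subset ~: S.
Proof.
apply/subsetP => y; rewrite !inE => /forall_inP outy.
by apply: contraTN isT => /outy; rewrite arc_irr.
Qed.

Lemma common_outU1 (p : D) (S : {set D}) :
  common_out (p |: S) = [set y in common_out S | arc p y].
Proof.
apply/setP => y; rewrite !inE; apply/forall_inP/andP => [outy|[/forall_inP outy py] x].
  split; last by apply: outy; rewrite setU11.
  by apply/forall_inP => x xS; apply: outy; rewrite setU1r.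
by case/setU1P => [->|/outy].
Qed.

Lemma common_out_full (T : {set D}) :
  0 < lambda -> t <= #|D| -> #|T|.+2 = t -> common_out T = ~: T.
Proof.
move=> lam_gt0 letD cT; apply/eqP; rewrite eqEcard common_out_disjoint /=.
have pairP : {in ~: T &, forall p q, p != q ->
    #|[set b in common_out T | arc p b && arc q b]| = lambda}.
  (* Blocks through [p] and [q] are the common out-neighbours of a set of [t] vertices. *)
  move=> p q; rewrite !inE => pT qT pq; rewrite -(liking (S := p |: (q |: T))).
    apply: eq_card => b; rewrite !common_outU1 !inE.
    by rewrite -andbA [arc q b && _]andbC.
  by rewrite !cardsU1 !inE negb_or pq pT qT.
apply: (fisher_inequality pairP) => p pT.
(* A second point exists since [T] and [p] make up only [t - 1] vertices; it yields a block through
   [p], as [lambda] is positive. *)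
have [q qT pq] : exists2 q, q \in ~: T & p != q.
  have /set0Pn[q] : ~: (p |: T) != set0.
    rewrite -card_gt0 cardsCs setCK cardsU1 subn_gt0.
    by move: pT; rewrite inE => ->; rewrite add1n cT.
  by rewrite !inE negb_or eq_sym => /andP[pq qT]; exists q; rewrite ?inE.
(* A block [y] through [p] is a point other than [p] that does not lie on
   itself, so the [lambda] blocks joining [p] and [y] miss the block [y]. *)
have /card_gt0P[y] : 0 < #|[set b in common_out T | arc p b && arc q b]|.
  by rewrite pairP.
rewrite inE => /and3P[yT py _].
have yCT : y \in ~: T by exact: subsetP (common_out_disjoint T) _ yT.
have npy : p != y by apply: contraTneq py => <-; rewrite arc_irr.
rewrite -(pairP _ _ pT yCT npy); apply: proper_card; apply/properP; split.
  by apply/subsetP => b; rewrite !inE => /and3P[-> ->].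
by exists y; rewrite !inE ?arc_irr ?andbF //= py andbT; move: yT; rewrite inE.
Qed.

Lemma liking_complete (x y : D) :
  2 < t -> 0 < lambda -> t <= #|D| -> arc x y = (x != y).
Proof.
move=> t_gt2 lam_gt0 letD.
case: eqVneq => [->|xy]; first exact: arc_irr.
(* Extend [[set x; y]] to [t - 1 >= 2] vertices, then drop [y]. *)
have [T sT cT] : exists2 T : {set D}, [set x] \subset T /\ y \notin T & #|T|.+2 = t.
  have [|U sU cU] := @set_of_card D [set x; y] t.-1.
    by rewrite cards2 xy; case: t t_gt2 letD => // n; rewrite ltnS => -> /ltnW.
  have [xU yU] : x \in U /\ y \in U.
    by split; apply: (subsetP sU); rewrite !inE eqxx ?orbT.
  exists (U :\ y); first by rewrite sub1set !inE eqxx xy xU.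
  by move: (cardsD1 y U); rewrite yU cU add1n => <-; rewrite prednK // (ltn_trans _ t_gt2).
case: sT; rewrite sub1set => xT yT.
have : y \in common_out T by rewrite common_out_full // inE.
by rewrite inE => /forall_inP; apply.
Qed.

End Liking.

Lemma common_out_complete (D : digraph) (S : {set D}) :
  (forall x y : D, arc x y = (x != y)) -> common_out S = ~: S.
Proof.
move=> arcE; apply/eqP; rewrite eqEsubset common_out_disjoint /=.
apply/subsetP => y; rewrite !inE => yS; apply/forall_inP => x xS.
by rewrite arcE; apply: contraNneq yS => <-.
Qed.

Lemma complete_two_way_liking (t lambda : nat) :
  two_way_liking t lambda (complete_digraph (t + lambda)).
Proof.
move=> S cS.
have cCS : #|~: S| = lambda by rewrite cardsCs setCK card_ord cS addKn.
have outE := @common_out_complete (complete_digraph (t + lambda)) S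
  (fun _ _ => erefl).
split; first by rewrite outE.
(* Arcs are symmetric here, so common in- and out-neighbours coincide. *)
rewrite -[RHS]cCS -outE; apply: eq_card => y; rewrite !inE.
by apply: eq_forallb => x; rewrite /= eq_sym.
Qed.

(** The bound [t <= #|D|] excludes the digraphs that satisfy the liking condition vacuously. *)
Theorem theorem1p2 (t lambda : nat) (ht : 3 <= t) (hlambda : 1 <= lambda) :
  two_way_liking t lambda (complete_digraph (t + lambda)) /\
  (forall D : digraph, t <= #|D| -> two_way_liking t lambda D ->
     digraph_iso D (complete_digraph (t + lambda))).
Proof.
split=> [|D letD likD]; first exact: complete_two_way_liking.
have outD (S : {set D}) (cS : #|S| = t) := proj1 (likD S cS).
have arcE (x y : D) : arc x y = (x != y) := liking_complete outD x y ht hlambda letD.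
have cD : #|D| = t + lambda.
  (* By completeness, the [lambda] common out-neighbours of a [t]-set form its complement. *)
  have [|S _ cS] := @set_of_card D set0 t; first by rewrite cards0.
  by rewrite -(outD S cS) common_out_complete // -cS cardsC.
(* Any bijection works, since arcs on both sides are just inequality. *)
exists (fun x : D => cast_ord cD (enum_rank x)) => [|x y].
  exact: bij_comp (Bijective (cast_ordK cD) (cast_ordKV cD)) (@enum_rank_bij D).
by rewrite arcE /= (inj_eq (@cast_ord_inj _ _ cD)) (inj_eq enum_rank_inj).
Qed.
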